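(* The set of patterns $\{4231, 5276143\}$ is Wilf-equivalent to the pattern $4321$ on involutions. Moreover, for all $n\ge 0$, $|I_n(4231,5276143)| = |I_n(4321)| = M_n$, the $n$th Motzkin number.
   Context: A permutation $\sigma$ is an involution if $\sigma^{-1}=\sigma$. $I_n(\Pi)$ denotes the set of involutions of length $n$ avoiding every pattern in $\Pi$ (classical pattern avoidance: no subsequence order-isomorphic to the pattern). Wilf-equivalence on involutions means $|I_n(\Pi)|=|I_n(\Pi')|$ for all $n$. The Motzkin numbers $M_n$ are $1,1,2,4,9,21,\dots$. *)

(* Defs.v *)
From mathcomp Require Import all_boot all_order all_fingroup all_algebra.

Set Implicit Arguments.
Unset Strict Implicit.
Unset Printing Implicit Defensive.

Import GRing.Theory Num.Theory.

(* A pattern is given by its one-line notation p = [:: p_1; ...; p_k].       *)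
(* The finite function f lists the positions of an occurrence of p in s,     *)
(* in increasing order.                                                      *)
Definition contains (n : nat) (p : seq nat) (s : 'S_n) : bool :=
  [exists f : {ffun 'I_(size p) -> 'I_n},
    [forall i : 'I_(size p), forall j : 'I_(size p),
       ((i < j) ==> (f i < f j))
       && ((s (f i) < s (f j)) == (nth 0 p i < nth 0 p j))]].

Definition avoids (n : nat) (Pi : seq (seq nat)) (s : 'S_n) : bool :=
  all (fun p => ~~ contains p s) Pi.

Definition avoiding_involutions (n : nat) (Pi : seq (seq nat)) : {set 'S_n} :=
  [set s : 'S_n | (s^-1 == s)%g && avoids Pi s].

Definition Wilf_equiv_involutions (Pi Pi' : seq (seq nat)) : Prop :=
  forall n : nat,
    #|avoiding_involutions n Pi| = #|avoiding_involutions n Pi'|.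

(* A step x : 'I_3 has height change x - 1, so 0, 1, 2 encode a down step, a *)
(* level step and an up step.                                                *)
Definition path_height (t : seq 'I_3) : int :=
  (\sum_(x <- t) ((x : nat)%:Z - 1))%R.

Definition is_Motzkin_path (n : nat) (t : n.-tuple 'I_3) : bool :=
  [forall k : 'I_n.+1, 0 <= path_height (take k t)]%R
  && (path_height t == 0%R).

Definition Motzkin (n : nat) : nat :=
  #|[set t : n.-tuple 'I_3 | is_Motzkin_path t]|.

(* Main.v *)
Require Import Defs.
From mathcomp Require Import all_boot all_order all_fingroup all_algebra.
From mathcomp Require Import zify.

(* Call the left-to-right maxima and right-to-left minima of a permutation,   *)
(* as points of its diagram, its skeleton; the other points are interior.     *)
(* A permutation avoids 4321 iff its interior points increase, and sorting    *)
(* the interior values keeps the skeleton, so every skeleton class has        *)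
(* exactly one 4321-avoider. Every class also has exactly one                 *)
(* {4231, 5276143}-avoider: in an occurrence of 4231 (resp. 5276143) the      *)
(* interior letters 2, 3 (resp. 2, 6, 4) may be replaced by 3, 2 (resp.       *)
(* 4, 2, 6) within the class, so the lexicographic maximum of the class is an *)
(* avoider; and if s < t are lexicographically ordered members of one class,  *)
(* then the first place where they differ produces an occurrence in s.        *)
(* Inversion acts on skeletons and preserves both pattern sets, so on either  *)
(* side the avoiding involutions correspond to the symmetric skeletons.       *)
(* An involution avoids 4321 iff no two of its 2-cycles are nested; it is     *)
(* then recovered from the word recording i < s i, i = s i, i > s i by        *)
(* matching the m-th up step with the m-th down step, and these words are     *)
(* exactly the Motzkin paths.                                                 *)

Set Implicit Arguments.
Unset Strict Implicit.
Unset Printing Implicit Defensive.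

(** Both families of avoiders are compared with a third count, the number of skeletons invariant
    under inversion. [card_involutions_skeleton] makes this comparison for any family closed under
    inversion that meets every skeleton class exactly once. Existence of the representative is an
    extremality argument: the lexicographic minimum of a class avoids 4321 by [contains4321_lexlt],
    and its maximum avoids the pair by [contains4231_lexlt] and [contains5276143_lexlt]. Uniqueness
    is [lexlt_contains4321] and, the hardest point, [lexlt_contains_pair].

    The Motzkin count is made on the 4321 side only: [matching_word] recovers a nonnesting
    involution from its word, and [Motzkin_path_is_word] shows that every Motzkin path arises. *)

Lemma exists_maximal (T : finType) (r : rel T) (P : pred T) (x : T) :
  irreflexive r -> transitive r -> P x ->
  exists2 y, P y & forall z, P z -> ~~ r y z.
Proof.
(* The number of predecessors grows strictly along [r], so an element with the most predecessors is
   maximal. *)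
move=> rirr rtr Px; case: (arg_maxnP (fun y => #|[set z | r z y]|) Px) => y Py max_y.
exists y => // z Pz; apply/negP => ryz.
have := max_y z Pz; rewrite /= leqNgt => /negP; apply; apply: proper_card.
apply/properP; split; last by exists y; rewrite inE ?rirr.
by apply/subsetP=> u; rewrite !inE => /rtr; apply.
Qed.

Section Permutations.

Variable n : nat.
Implicit Types (s t : 'S_n) (i j k : 'I_n).

(** * Pattern occurrences and inversion *)

(** Consecutive positions and consecutive values suffice, since the remaining comparisons follow by
    transitivity; the same holds for the other two patterns. *)
Lemma contains4321P s :
  reflect (exists a b c d : 'I_n, a < b < c /\ c < d /\
             [&& s d < s c, s c < s b & s b < s a])
          (contains [:: 4; 3; 2; 1] s).
Proof.
apply: (iffP existsP) => [[f /forallP fP]|[a [b [c [d [abc [cd sP]]]]]]].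
  have fE (i j : 'I_4) := forallP (fP i) j.
  pose o l (ll : l < 4) := Ordinal ll.
  exists (f (o 0 isT)), (f (o 1 isT)), (f (o 2 isT)), (f (o 3 isT)).
  move: (fE (o 0 isT) (o 1 isT)) (fE (o 1 isT) (o 2 isT)) (fE (o 2 isT) (o 3 isT)).
  move: (fE (o 1 isT) (o 0 isT)) (fE (o 2 isT) (o 1 isT)) (fE (o 3 isT) (o 2 isT)).
  by rewrite /=; lia.
exists [ffun i : 'I_4 => nth a [:: a; b; c; d] i].
by do 2![apply/forallP=> -[[|[|[|[|?]]]] ?] //]; rewrite !ffunE /=; lia.
Qed.

Lemma contains4231P s :
  reflect (exists a b c d : 'I_n, a < b < c /\ c < d /\
             [&& s d < s b, s b < s c & s c < s a])
          (contains [:: 4; 2; 3; 1] s).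
Proof.
apply: (iffP existsP) => [[f /forallP fP]|[a [b [c [d [abc [cd sP]]]]]]].
  have fE (i j : 'I_4) := forallP (fP i) j.
  pose o l (ll : l < 4) := Ordinal ll.
  exists (f (o 0 isT)), (f (o 1 isT)), (f (o 2 isT)), (f (o 3 isT)).
  move: (fE (o 0 isT) (o 1 isT)) (fE (o 1 isT) (o 2 isT)) (fE (o 2 isT) (o 3 isT)).
  move: (fE (o 3 isT) (o 1 isT)) (fE (o 2 isT) (o 0 isT)).
  by rewrite /=; lia.
exists [ffun i : 'I_4 => nth a [:: a; b; c; d] i].
by do 2![apply/forallP=> -[[|[|[|[|?]]]] ?] //]; rewrite !ffunE /=; lia.
Qed.

Lemma contains5276143P s :
  reflect (exists a b c d e f g : 'I_n,
             [&& a < b, b < c, c < d, d < e, e < f & f < g] /\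
             [&& s e < s b, s b < s g, s g < s f, s f < s a, s a < s d & s d < s c])
          (contains [:: 5; 2; 7; 6; 1; 4; 3] s).
Proof.
apply: (iffP existsP) => [[f /forallP fP]|[a [b [c [d [e [f [g [pP sP]]]]]]]]].
  have fE (i j : 'I_7) := forallP (fP i) j.
  pose o l (ll : l < 7) := Ordinal ll.
  exists (f (o 0 isT)), (f (o 1 isT)), (f (o 2 isT)), (f (o 3 isT)).
  exists (f (o 4 isT)), (f (o 5 isT)), (f (o 6 isT)).
  split.
    move: (fE (o 0 isT) (o 1 isT)) (fE (o 1 isT) (o 2 isT)) (fE (o 2 isT) (o 3 isT)).
    move: (fE (o 3 isT) (o 4 isT)) (fE (o 4 isT) (o 5 isT)) (fE (o 5 isT) (o 6 isT)).
    by rewrite /=; lia.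
  move: (fE (o 4 isT) (o 1 isT)) (fE (o 1 isT) (o 6 isT)) (fE (o 6 isT) (o 5 isT)).
  move: (fE (o 5 isT) (o 0 isT)) (fE (o 0 isT) (o 3 isT)) (fE (o 3 isT) (o 2 isT)).
  by rewrite /=; lia.
exists [ffun i : 'I_7 => nth a [:: a; b; c; d; e; f; g] i].
by do 2![apply/forallP=> -[[|[|[|[|[|[|[|?]]]]]]] ?] //]; rewrite !ffunE /=; lia.
Qed.

(** All three patterns are involutions, so the values of an occurrence in [s^-1], listed in
    increasing order, are the positions of an occurrence in [s]. *)
Lemma contains4321V s :
  contains [:: 4; 3; 2; 1] s^-1 -> contains [:: 4; 3; 2; 1] s.
Proof.
move=> /contains4321P[a [b [c [d [abc [cd vP]]]]]]; apply/contains4321P.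
exists (s^-1 d)%g, (s^-1 c)%g, (s^-1 b)%g, (s^-1 a)%g.
by rewrite !permKV; lia.
Qed.

Lemma contains4231V s :
  contains [:: 4; 2; 3; 1] s^-1 -> contains [:: 4; 2; 3; 1] s.
Proof.
move=> /contains4231P[a [b [c [d [abc [cd vP]]]]]]; apply/contains4231P.
exists (s^-1 d)%g, (s^-1 b)%g, (s^-1 c)%g, (s^-1 a)%g.
by rewrite !permKV; lia.
Qed.

Lemma contains5276143V s :
  contains [:: 5; 2; 7; 6; 1; 4; 3] s^-1 ->
  contains [:: 5; 2; 7; 6; 1; 4; 3] s.
Proof.
move=> /contains5276143P[a [b [c [d [e [f [g [pP vP]]]]]]]].
apply/contains5276143P.
exists (s^-1 e)%g, (s^-1 b)%g, (s^-1 g)%g, (s^-1 f)%g, (s^-1 a)%g, (s^-1 d)%g, (s^-1 c)%g.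
by rewrite !permKV; lia.
Qed.

(** * Skeletons *)

Definition lrmax s i := [forall j : 'I_n, (j < i) ==> (s j < s i)].
Definition rlmin s i := [forall j : 'I_n, (i < j) ==> (s i < s j)].

(** The elements are points (position, value), so equal skeletons fix the values as well, and
    inversion merely transposes the points and exchanges the two sets. *)
Definition skeleton s : {set 'I_n * 'I_n} * {set 'I_n * 'I_n} :=
  ([set x | (s x.1 == x.2) && lrmax s x.1],
   [set x | (s x.1 == x.2) && rlmin s x.1]).

Lemma lrmaxP s i : reflect (forall j, j < i -> s j < s i) (lrmax s i).
Proof. by apply: (iffP forallP) => H j; [move/implyP: (H j)|apply/implyP/H]. Qed.

Lemma rlminP s i : reflect (forall j, i < j -> s i < s j) (rlmin s i).
Proof. by apply: (iffP forallP) => H j; [move/implyP: (H j)|apply/implyP/H]. Qed.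

Lemma perm_ord_neq s i j : i < j -> (s i : nat) <> s j.
Proof. by move=> ij /val_inj/perm_inj eij; rewrite eij ltnn in ij. Qed.

(** The largest value to the left of [i] is attained at a left-to-right maximum. *)
Lemma exists_lrmax s i : ~~ lrmax s i ->
  exists m : 'I_n, [/\ m < i, s i < s m & lrmax s m].
Proof.
rewrite negb_forall => /existsP[j0]; rewrite negb_imply -leqNgt => /andP[j0i le0].
case: (arg_maxnP (fun m => s m : nat) (j0i : (fun m : 'I_n => m < i) j0)) => m mi max_m.
have := perm_ord_neq (s := s) mi; have := max_m _ j0i => h1 h2.
exists m; split => //; first by move: h1 h2 le0; rewrite /=; lia.
apply/lrmaxP => j jm; have := max_m j (ltn_trans jm mi).
by have := perm_ord_neq (s := s) jm; rewrite /=; lia.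
Qed.

Lemma exists_rlmin s i : ~~ rlmin s i ->
  exists m : 'I_n, [/\ i < m, s m < s i & rlmin s m].
Proof.
rewrite negb_forall => /existsP[j0]; rewrite negb_imply -leqNgt => /andP[j0i le0].
case: (arg_minnP (fun m => s m : nat) (j0i : (fun m : 'I_n => i < m) j0)) => m mi min_m.
have := perm_ord_neq (s := s) mi; have := min_m _ j0i => h1 h2.
exists m; split => //; first by move: h1 h2 le0; rewrite /=; lia.
apply/rlminP => j jm; have := min_m j (ltn_trans mi jm).
by have := perm_ord_neq (s := s) jm; rewrite /=; lia.
Qed.

Lemma skeleton_lrmax s t i : skeleton s = skeleton t -> lrmax s i ->
  t i = s i /\ lrmax t i.
Proof.
by move=> [/setP/(_ (i, s i)) + _] li; rewrite !inE /= eqxx li /= => /esym/andP[/eqP].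
Qed.

Lemma skeleton_rlmin s t i : skeleton s = skeleton t -> rlmin s i ->
  t i = s i /\ rlmin t i.
Proof.
by move=> [_ /setP/(_ (i, s i))] + li; rewrite !inE /= eqxx li /= => /esym/andP[/eqP].
Qed.

Lemma skeleton_diff s t i : skeleton s = skeleton t -> s i <> t i ->
  ~~ lrmax s i /\ ~~ rlmin s i.
Proof.
move=> est dst; split; apply/negP.
  by case/(skeleton_lrmax est) => /esym.
by case/(skeleton_rlmin est) => /esym.
Qed.

(** Reflection in the diagonal exchanges the upper left and the lower right quadrant of a point. *)
Lemma lrmaxV s i : lrmax s^-1 (s i) = rlmin s i.
Proof.
apply/lrmaxP/rlminP => H j ij.
  rewrite ltnNge; apply/negP => le_s; have := perm_ord_neq (s := s) ij => ne.
  by have := H (s j); rewrite !permK; lia.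
rewrite permK ltnNge; apply/negP => le_s.
have [eij|ne] := eqVneq i (s^-1%g j); first by rewrite eij permKV ltnn in ij.
have {}ne : (i : nat) <> s^-1%g j by move=> /val_inj/eqP; apply/negP.
by have := H (s^-1%g j); rewrite permKV; lia.
Qed.

Lemma skeletonV s : skeleton s^-1 =
  ([set x | (x.2, x.1) \in (skeleton s).2], [set x | (x.2, x.1) \in (skeleton s).1]).
Proof.
have eqV i j : (s^-1%g i == j) = (s j == i).
  by rewrite (can2_eq (permKV s) (permK s)) eq_sym.
congr pair; apply/setP => -[i j]; rewrite !inE /= eqV; case: eqP => //= <-.
  exact: lrmaxV.
by rewrite -(lrmaxV s^-1%g) permK invgK.
Qed.

Lemma eq_skeletonV s t : skeleton s = skeleton t -> skeleton s^-1 = skeleton t^-1.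
Proof. by rewrite !skeletonV => ->. Qed.

(** The points over [P] have common points [m] to the upper left and [r] to the lower right, so they
    are interior in both diagrams. Nor do they decide whether another point is extremal: whatever
    they would obstruct, [m] or [r] obstructs already. *)
Lemma eq_skeleton s t (P : {pred 'I_n}) :
  {in [predC P], s =1 t} ->
  {in P, forall i, exists m r : 'I_n, [/\ m \notin P, r \notin P,
     m < i < r, s r < s i < s m & s r < t i < s m]} ->
  skeleton s = skeleton t.
Proof.
move=> est dom.
(* As [m] and [r] lie outside [P], the hypotheses are symmetric in the two permutations, so one
   implication is enough. *)
suff H (u v : 'S_n) : {in [predC P], u =1 v} ->
    {in P, forall i, exists m r : 'I_n, [/\ m \notin P, r \notin P,
     m < i < r, u r < u i < u m & u r < v i < u m]} ->
    forall i, (lrmax u i -> lrmax v i /\ u i = v i) /\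
              (rlmin u i -> rlmin v i /\ u i = v i).
  have H1 := H s t est dom.
  have H2 : forall i, (lrmax t i -> lrmax s i /\ t i = s i) /\
              (rlmin t i -> rlmin s i /\ t i = s i).
    apply: H => [i /est //|i Pi]; have [m [r [Pm Pr mir h1 h2]]] := dom i Pi.
    by exists m, r; rewrite -(est m) -?(est r).
  congr pair; apply/setP => -[i j]; rewrite !inE /=.
    apply/andP/andP => -[/eqP <-]; first by case/(proj1 (H1 i)) => ? ->.
    by case/(proj1 (H2 i)) => ? ->.
  apply/andP/andP => -[/eqP <-]; first by case/(proj2 (H1 i)) => ? ->.
  by case/(proj2 (H2 i)) => ? ->.
move=> {est dom s t} euv dom i.
split=> [/lrmaxP li|/rlminP li].
  have Pi : i \notin P.
    by apply/negP => /dom [m [r [_ _ /andP[/li]]]]; lia.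
  split; last exact: euv.
  apply/lrmaxP => j ji; rewrite -(euv i) //.
  have [/dom [m [r [Pm _ mjr _ vj]]]|Pj] := boolP (j \in P).
    by have := li m; lia.
  by rewrite -euv //; apply: li.
have Pi : i \notin P.
  by apply/negP => /dom [m [r [_ _ /andP[_ /li]]]]; lia.
split; last exact: euv.
apply/rlminP => j ji; rewrite -(euv i) //.
have [/dom [m [r [_ Pr mjr _ vj]]]|Pj] := boolP (j \in P).
  by have := li r; lia.
by rewrite -euv //; apply: li.
Qed.

(** * Lexicographic comparison within a skeleton class *)

Definition lexlt s t :=
  [exists p : 'I_n, (s p < t p) && [forall j : 'I_n, (j < p) ==> (s j == t j)]].

Lemma lexltP s t :
  reflect (exists2 p : 'I_n, s p < t p & forall j, j < p -> s j = t j) (lexlt s t).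
Proof.
apply: (iffP existsP) => [[p /andP[st /forallP H]]|[p st H]]; exists p => //.
  by move=> j jp; apply/eqP/(implyP (H j)).
by rewrite st /=; apply/forallP => j; apply/implyP => /H ->.
Qed.

Lemma lexlt_irr : irreflexive lexlt.
Proof. by move=> s; apply/negbTE/negP => /lexltP[p]; rewrite ltnn. Qed.

Lemma lexlt_trans : transitive lexlt.
Proof.
move=> t s u /lexltP[p st Hp] /lexltP[q tu Hq]; apply/lexltP.
case: (ltngtP p q) => pq.
- by exists p => [|j jp]; [rewrite -Hq|rewrite Hp // Hq // (ltn_trans jp)].
- by exists q => [|j jp]; [rewrite Hp|rewrite -Hq // Hp // (ltn_trans jp)].
have {}pq := val_inj pq; rewrite {}pq in st Hp *.
by exists q => [|j jp]; [exact: ltn_trans tu|rewrite Hp // Hq].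
Qed.

Lemma lexlt_total s t : s <> t -> lexlt s t \/ lexlt t s.
Proof.
move=> dst; have [p0 dp0] : exists p, s p != t p.
  apply/existsP; rewrite -negb_forall; apply/negP => /forallP H.
  by apply: dst; apply/permP => i; apply/eqP.
case: (arg_minnP (fun i => i : nat) (dp0 : (fun p => s p != t p) p0)) => p dp min_p.
have eqj j : j < p -> s j = t j.
  by move=> jp; apply/eqP; apply: contraTT jp => /min_p; rewrite -leqNgt.
case: (ltngtP (s p) (t p)) => [lt|lt|/val_inj/eqP]; last by rewrite (negPf dp).
  by left; apply/lexltP; exists p.
by right; apply/lexltP; exists p => // j /eqj.
Qed.

(** Before [i] the two permutations agree, and there [t] does not yet take the value [t i]. *)
Lemma first_diff_lt s t i :
  (forall k, k < i -> s k = t k) -> s i <> t i -> i < s^-1%g (t i).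
Proof.
move=> eq_i d; rewrite ltnNge; apply/negP; rewrite leq_eqVlt => /orP[/eqP/val_inj e|lt].
  by apply: d; rewrite -{1}e permKV.
by have := eq_i _ lt; rewrite permKV => /perm_inj e; rewrite -e ltnn in lt.
Qed.

(** At the first difference [p], the smaller value [s p] occurs in [t] at a later [q]. Both points
    are interior in [t], so a larger value before [p] and a smaller one after [q] complete the
    pattern. *)
Lemma lexlt_contains4321 s t : skeleton s = skeleton t -> lexlt s t ->
  contains [:: 4; 3; 2; 1] t.
Proof.
move=> est /lexltP[p lt_p eq_p].
pose q := (t^-1%g (s p)); have tq : t q = s p by rewrite permKV.
have dp : t p <> s p by move=> e; rewrite e ltnn in lt_p.
have pq : p < q by apply: first_diff_lt => // k /eq_p.
have dq : t q <> s q by rewrite tq => /perm_inj e; rewrite e ltnn in pq.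
have [/exists_lrmax[m [mp sm _]] _] := skeleton_diff (esym est) dp.
have [_ /exists_rlmin[r [qr sr _]]] := skeleton_diff (esym est) dq.
by apply/contains4321P; exists m, p, q, r; move: sr; rewrite tq; lia.
Qed.

(** At the first difference [p], the larger value [t p] occurs in [s] at a later [q]. With [m] above
    and to the left, and a low right-to-left minimum [r] after [q], the letters at [m], [p], [q],
    [r] form 4231. If instead [r] precedes [q], counting values before [r] yields another displaced
    point [k] between [p] and [r], which gives 4231 or completes 5276143. *)
Lemma lexlt_contains_pair s t : skeleton s = skeleton t -> lexlt s t ->
  contains [:: 4; 2; 3; 1] s \/ contains [:: 5; 2; 7; 6; 1; 4; 3] s.
Proof.
move=> est /lexltP[p lt_p eq_p].
have dp : s p <> t p by move=> e; rewrite e ltnn in lt_p.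
pose q := s^-1%g (t p); have sq : s q = t p by rewrite permKV.
pose q' := t^-1%g (s p); have tq' : t q' = s p by rewrite permKV.
have pq : p < q := first_diff_lt eq_p dp.
have pq' : p < q' by apply: first_diff_lt => [k /eq_p//|]; apply: nesym.
have dq : s q <> t q by rewrite sq => /perm_inj e; rewrite e ltnn in pq.
have dq' : t q' <> s q' by rewrite tq' => /perm_inj e; rewrite e ltnn in pq'.
have [/exists_lrmax[m [mp tm _]] _] := skeleton_diff (esym est) (nesym dp).
rewrite -(eq_p m mp) in tm.
have [_ /exists_rlmin[r0 [q'r0 sr0 min_r0]]] := skeleton_diff (esym est) dq'.
rewrite tq' in sr0.
have [{min_r0}sr0E min_r0] := skeleton_rlmin (esym est) min_r0.
rewrite -sr0E in sr0.
(* The rightmost such [r] is chosen, so that every later right-to-left minimum of [s] lies above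
   [s p]; this applies to [r'] once [r < q]. *)
pose Q (r : 'I_n) := rlmin s r && (s r < s p).
have Qr0 : Q r0 by rewrite /Q min_r0.
case: (arg_maxnP (fun r : 'I_n => r : nat) Qr0) => r /andP[min_r sr] max_r.
have q'r : q' < r by apply: leq_trans q'r0 (max_r _ Qr0).
have [tr min_tr] := skeleton_rlmin est min_r.
have [_ /exists_rlmin[r' [qr' sr' min_r']]] := skeleton_diff est dq.
rewrite sq in sr'.
have [rq|qr] := ltnP q r.
  by left; apply/contains4231P; exists m, p, q, r; rewrite sq; lia.
have {}qr : r < q.
  rewrite ltn_neqAle qr andbT; apply/eqP => /val_inj e; rewrite -e in dq.
  by rewrite tr in dq.
have sr'p : s p < s r'.
  rewrite ltnNge; apply/negP => le; have ne := perm_ord_neq (s := s) (ltn_trans pq qr').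
  have /max_r /= : Q r' by rewrite /Q min_r' /=; lia.
  by lia.
pose B := [set i : 'I_n | i < r].
(* Pigeonhole: t p is in t @: B but not in s @: B, so some z is in s @: B but *)
(* not in t @: B. *)
have [z zB zB'] : exists2 z, z \in s @: B & z \notin t @: B.
  apply/subsetPn; apply/negP => sub.
  have /eqP eB : s @: B == t @: B.
    by rewrite eqEcard sub !card_imset ?leqnn //; exact: (@perm_inj _ _).
  have : t p \in s @: B.
    by rewrite eB imset_f // inE (ltn_trans pq').
  case/imsetP=> i; rewrite inE -sq => ir /perm_inj e; rewrite -e in ir.
  by move: ir qr; lia.
case/imsetP: zB => k; rewrite inE => kr zE; subst z.
pose k' := t^-1%g (s k); have tk' : t k' = s k by rewrite permKV.
have k'r : r <= k'.
  rewrite leqNgt; apply/negP => k'r; move/negP: zB'; apply.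
  by rewrite -tk' imset_f // inE.
have dk : s k <> t k by rewrite -tk' => /perm_inj e; move: kr k'r; rewrite e; lia.
have dk' : t k' <> s k' by rewrite tk' => /perm_inj e; move: kr k'r; rewrite e; lia.
have pk : p < k.
  rewrite ltnNge; apply/negP; rewrite leq_eqVlt => /orP[/eqP/val_inj e|kp].
    by move: k'r; rewrite /k' e -/q'; lia.
  by apply: dk; apply: eq_p.
(* Otherwise [k'], interior in [t], has a right-to-left minimum after it, hence beyond [r], with
   value below [s p], against the choice of [r]. *)
have spk : s p < s k.
  rewrite ltnNge; apply/negP => le.
  have [_ /exists_rlmin[x [k'x tx min_x]]] := skeleton_diff (esym est) dk'.
  have [sx {}min_x] := skeleton_rlmin (esym est) min_x.
  rewrite tk' in tx; rewrite -sx in tx.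
  have /max_r /= : Q x by rewrite /Q min_x /=; lia.
  by lia.
have [/exists_lrmax[m' [m'k sm' _]] _] := skeleton_diff est dk.
(* The point [k] is the 3 of a 4231 with first letter [m] or [m'], unless [s k] exceeds [s m] and
   [m'] lies between [p] and [k]. *)
have [le|lt] := leqP (s k) (s m).
  have ne := perm_ord_neq (s := s) (ltn_trans mp pk).
  by left; apply/contains4231P; exists m, p, k, r; lia.
have [m'p|pm'] := ltnP m' p.
  by left; apply/contains4231P; exists m', p, k, r; lia.
right; apply/contains5276143P; exists m, p, m', k, r, q, r'; rewrite sq.
have : (p : nat) <> m' by move=> /val_inj e; rewrite -e in sm'; lia.
by lia.
Qed.

(** * Moves inside a skeleton class *)

(** The two middle letters are exchanged; the outer ones stay in place and keep them interior. *)
Lemma contains4321_lexlt s : contains [:: 4; 3; 2; 1] s ->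
  exists2 t, skeleton t = skeleton s & lexlt t s.
Proof.
case/contains4321P => a [b [c [d [abc [cd sP]]]]].
have tb : (tperm b c * s)%g b = s c by rewrite permM tpermL.
have tc : (tperm b c * s)%g c = s b by rewrite permM tpermR.
have tj j : j != b -> j != c -> (tperm b c * s)%g j = s j.
  by move=> ? ?; rewrite permM tpermD // eq_sym.
exists (tperm b c * s)%g; last first.
  by apply/lexltP; exists b => [|j jb]; [rewrite tb|rewrite tj // -val_eqE /=]; lia.
apply/esym; apply: (@eq_skeleton _ _ (pred2 b c)) => [j|j].
  by rewrite !inE => /norP[? ?]; rewrite tj.
by rewrite !inE => /orP[]/eqP->; exists a, d; rewrite ?tb ?tc !inE -!val_eqE /=; split; lia.
Qed.

Lemma contains4231_lexlt s : contains [:: 4; 2; 3; 1] s ->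
  exists2 t, skeleton t = skeleton s & lexlt s t.
Proof.
case/contains4231P => a [b [c [d [abc [cd sP]]]]].
have tb : (tperm b c * s)%g b = s c by rewrite permM tpermL.
have tc : (tperm b c * s)%g c = s b by rewrite permM tpermR.
have tj j : j != b -> j != c -> (tperm b c * s)%g j = s j.
  by move=> ? ?; rewrite permM tpermD // eq_sym.
exists (tperm b c * s)%g; last first.
  by apply/lexltP; exists b => [|j jb]; [rewrite tb|rewrite tj // -val_eqE /=]; lia.
apply/esym; apply: (@eq_skeleton _ _ (pred2 b c)) => [j|j].
  by rewrite !inE => /norP[? ?]; rewrite tj.
by rewrite !inE => /orP[]/eqP->; exists a, d; rewrite ?tb ?tc !inE -!val_eqE /=; split; lia.
Qed.

(* The letters 2, 6, 4 of the occurrence are replaced by 4, 2, 6. *)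
Lemma contains5276143_lexlt s : contains [:: 5; 2; 7; 6; 1; 4; 3] s ->
  exists2 t, skeleton t = skeleton s & lexlt s t.
Proof.
case/contains5276143P => a [b [c [d [e [f [g [pP sP]]]]]]].
(* Products act from left to right, so [t] takes at [b], [d], [f] the values of [s] at [f], [b],
   [d]. *)
pose t := (tperm b f * (tperm b d * s))%g.
have bd : b != d by rewrite -val_eqE /=; lia.
have bf : b != f by rewrite -val_eqE /=; lia.
have df : d != f by rewrite -val_eqE /=; lia.
have tb : t b = s f by rewrite !permM tpermL tpermD.
have td : t d = s b.
  have fd : f != d by rewrite eq_sym.
  by rewrite !permM (tpermD bd fd) tpermR.
have tf : t f = s d by rewrite !permM tpermR tpermL.
have tj j : j != b -> j != d -> j != f -> t j = s j.
  by move=> ? ? ?; rewrite !permM !tpermD // eq_sym.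
exists t; last first.
  by apply/lexltP; exists b => [|j jb]; [rewrite tb|rewrite tj // -val_eqE /=]; lia.
apply/esym; apply: (@eq_skeleton _ _ (pred3 b d f)) => [j|j].
  by rewrite !inE => /norP[? /norP[? ?]]; rewrite tj.
rewrite !inE => /or3P[]/eqP->; rewrite ?tb ?td ?tf.
(* Old and new letters lie below the 5 and above the 1 at [b], below the 7 and above the 1 at [d],
   and below the 7 and above the 3 at [f]. *)
- by exists a, e; rewrite !inE -!val_eqE /=; split; lia.
- by exists c, e; rewrite !inE -!val_eqE /=; split; lia.
- by exists c, g; rewrite !inE -!val_eqE /=; split; lia.
Qed.

(** * Counting avoiding involutions by symmetric skeletons *)

(** If a skeleton is invariant under inversion, the inverse of its representative in [Q] is again in
    [Q] with the same skeleton, so by uniqueness the representative is an involution. The right-hand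
    side does not mention [Q]. *)
Lemma card_involutions_skeleton (Q : pred 'S_n) :
  (forall s, Q s -> Q s^-1%g) ->
  (forall s t, Q s -> Q t -> skeleton s = skeleton t -> s = t) ->
  (forall s, exists2 t, Q t & skeleton t = skeleton s) ->
  #|[set s | (s^-1 == s)%g && Q s]|
    = #|skeleton @: [set s | skeleton s^-1 == skeleton s]|.
Proof.
move=> QV Qinj Qex; rewrite -(card_in_imset (f := skeleton)); last first.
  by move=> s t; rewrite !inE => /andP[_ Qs] /andP[_ Qt]; apply: Qinj.
congr #|pred_of_set _|; apply/setP => x; apply/imsetP/imsetP => -[s].
  by rewrite inE => /andP[/eqP sV Qs] ->; exists s; rewrite // inE sV.
rewrite inE => /eqP sV ->; have [t Qt est] := Qex s; exists t => //.
rewrite inE Qt andbT; apply/eqP/Qinj; [exact: QV|by []|].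
by rewrite (eq_skeletonV est) sV.
Qed.

Lemma card_involutions_avoiding4321_skeleton :
  #|avoiding_involutions n [:: [:: 4; 3; 2; 1]]|
    = #|skeleton @: [set s | skeleton s^-1 == skeleton s]|.
Proof.
apply: card_involutions_skeleton => [s|s t|s]; rewrite /avoids /= ?andbT.
- by apply: contra; apply: contains4321V.
- move=> As At est; apply/eqP/negPn/negP => /eqP/lexlt_total[] /lexlt_contains4321.
    by move/(_ est); apply/negP.
  by move/(_ (esym est)); apply/negP.
(* The order is reversed here: the avoider is the lexicographic minimum of its class. *)
have [||t /eqP est max_t] := @exists_maximal _ (fun s t => lexlt t s)
    (fun t => skeleton t == skeleton s) s _ _ (eqxx _).
- exact: lexlt_irr.
- by move=> t u v tu /lexlt_trans; apply.
exists t; rewrite // andbT; apply/negP => /contains4321_lexlt[u eut].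
by apply/negP/max_t; rewrite eut est.
Qed.

Lemma card_involutions_avoiding_pair_skeleton :
  #|avoiding_involutions n [:: [:: 4; 2; 3; 1]; [:: 5; 2; 7; 6; 1; 4; 3]]|
    = #|skeleton @: [set s | skeleton s^-1 == skeleton s]|.
Proof.
apply: card_involutions_skeleton => [s|s t|s]; rewrite /avoids /= ?andbT.
- by case/andP => A B; apply/andP; split; [apply: contra A; apply: contains4231V|
    apply: contra B; apply: contains5276143V].
- move=> As At est; apply/eqP/negPn/negP => /eqP/lexlt_total[] /lexlt_contains_pair.
    by case/(_ est)=> C; rewrite C ?andbF in As.
  by case/(_ (esym est))=> C; rewrite C ?andbF in At.
have [t /eqP est max_t] := @exists_maximal _ lexlt
    (fun t => skeleton t == skeleton s) s lexlt_irr lexlt_trans (eqxx _).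
exists t; rewrite // andbT.
apply/andP; split; apply/negP.
  by case/contains4231_lexlt => u eut; apply/negP/max_t; rewrite eut est.
by case/contains5276143_lexlt => u eut; apply/negP/max_t; rewrite eut est.
Qed.

End Permutations.

(** * Motzkin paths in terms of the positions of their steps *)

Lemma path_heightE (w : seq 'I_3) :
  path_height w = ((count_mem ord_max w)%:Z - (count_mem ord0 w)%:Z)%R.
Proof.
elim: w => [|x w IHw]; rewrite /path_height ?big_nil // big_cons.
rewrite [X in (_ + X)%R]IHw /=.
by case: x => [[|[|[|?]]] ?] //=; lia.
Qed.

(** In an increasing list the entries below [k] form a prefix. *)
Lemma count_ltn_sorted (l : seq nat) (m k : nat) : sorted ltn l -> m < size l ->
  (m < count (ltn^~ k) l) = (nth 0 l m < k).
Proof.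
elim: l m => //= x l IHl m xl.
have lx : all (ltn x) l by apply: order_path_min xl; apply: ltn_trans.
have [xk|kx] := ltnP x k; first by case: m => [|m] // ml; rewrite add1n ltnS IHl // (path_sorted xl).
rewrite (_ : count _ l = 0) ?ltn0; last first.
  apply/eqP; rewrite -leqn0 leqNgt -has_count; apply/hasPn => y /(allP lx) /= xy.
  by lia.
case: m => [|m] ml /=; first by lia.
by have /(allP lx) /= : nth 0 l m \in l by [rewrite mem_nth]; lia.
Qed.

Section MotzkinPaths.

Variable n : nat.
Implicit Types (s : 'S_n) (t : n.-tuple 'I_3) (x y : 'I_3) (i j : 'I_n).

Definition positions t x : seq 'I_n := [seq i <- enum 'I_n | tnth t i == x].

Lemma mem_positions t x i : (i \in positions t x) = (tnth t i == x).
Proof. by rewrite mem_filter mem_enum andbT. Qed.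

Lemma sorted_positions t x : sorted (fun i j => i < j) (positions t x).
Proof.
apply: sorted_filter; first by move=> ? ? ?; apply: ltn_trans.
by have := iota_ltn_sorted 0 n; rewrite -val_enum_ord sorted_map.
Qed.

Lemma uniq_positions t x : uniq (positions t x).
Proof. exact/filter_uniq/enum_uniq. Qed.

Lemma count_mem_take t x (k : nat) : k <= n ->
  count_mem x (take k t) = count (fun i => i < k) (positions t x).
Proof.
move=> kn; have eq_take : take k (enum 'I_n) = [seq i : 'I_n <- enum 'I_n | i < k].
  apply: (inj_map val_inj); rewrite map_take val_enum_ord take_iota.
  rewrite -(filter_map val (ltn^~ k)) val_enum_ord (minn_idPl kn).
  by rewrite -[k in ltn^~ k]add0n filter_iota_ltn.
rewrite -[in LHS](map_tnth_enum t) -map_take eq_take count_map !count_filter.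
by apply: eq_count => i /=; congr (_ && _); apply: andbC.
Qed.

Lemma Motzkin_pathP t : reflect
  (size (positions t ord0) = size (positions t ord_max) /\
   forall k : nat, k <= n ->
     count (fun i => i < k) (positions t ord0) <= count (fun i => i < k) (positions t ord_max))
  (is_Motzkin_path t).
Proof.
have sizeE x : size (positions t x) = count_mem x t.
  rewrite -[in RHS](take_size t) size_tuple count_mem_take //.
  by rewrite (@eq_count _ _ predT) ?count_predT // => i; apply: ltn_ord.
apply: (iffP andP) => [[/forallP pos /eqP]|[eq_sz pos]].
  rewrite path_heightE !sizeE => ht; split; first by lia.
  move=> k kn; have := pos (Ordinal (kn : k < n.+1)); rewrite path_heightE /=.
  by rewrite !count_mem_take //; lia.
split; last by rewrite path_heightE -!sizeE eq_sz; lia.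
apply/forallP => k; have kn : k <= n by rewrite -ltnS.
by rewrite path_heightE !count_mem_take //; have := pos k kn; lia.
Qed.

(** The prefix ending with the down step of index [m] has [m.+1] down steps, hence at least as many
    up steps. *)
Lemma Motzkin_positions_ltn t i0 (m : nat) : is_Motzkin_path t ->
  m < size (positions t ord_max) ->
  nth i0 (positions t ord_max) m < nth i0 (positions t ord0) m.
Proof.
case/Motzkin_pathP => eq_sz pos m_lt.
set u := nth i0 _ m; set d := nth i0 _ m.
have du : u != d.
  apply/eqP => e; have : u \in positions t ord_max by apply: mem_nth.
  have : d \in positions t ord0 by rewrite mem_nth // eq_sz.
  by rewrite !mem_positions -e => /eqP ->.
(* The prefix of length [d.+1] is the shortest one that includes position [d]. *)
suff : u < d.+1 by move: du; rewrite -val_eqE /=; lia.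
have countE x (k : nat) : m < size (positions t x) ->
    (m < count (fun i => i < k) (positions t x)) = (nth i0 (positions t x) m < k).
  move=> mx; have := @count_ltn_sorted (map val (positions t x)) m k.
  rewrite sorted_map size_map count_map (nth_map i0) //; apply => //.
  exact: sorted_positions.
rewrite -(countE ord_max) //; apply: leq_trans (pos _ (ltn_ord d)).
by rewrite countE ?eq_sz.
Qed.

(** * Nonnesting matchings and involutions *)

(** Up and down steps of equal rank are paired, and level steps are fixed. With as many up as down
    steps, the default of [nth] is never reached. *)
Definition matching t i : 'I_n :=
  if tnth t i == ord_max then nth i (positions t ord0) (index i (positions t ord_max))
  else if tnth t i == ord0 then nth i (positions t ord_max) (index i (positions t ord0))
  else i.

Lemma nth_index_positions t x y i (j := nth i (positions t y) (index i (positions t x))) :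
  size (positions t x) = size (positions t y) -> tnth t i = x ->
  tnth t j = y /\ nth j (positions t x) (index j (positions t y)) = i.
Proof.
move=> eq_sz /eqP; rewrite -mem_positions => ti.
have lt_i : index i (positions t x) < size (positions t y) by rewrite -eq_sz index_mem.
split; first by apply/eqP; rewrite -mem_positions mem_nth.
by rewrite index_uniq ?uniq_positions // (set_nth_default i) ?nth_index // eq_sz.
Qed.

Lemma matchingK t : size (positions t ord0) = size (positions t ord_max) ->
  involutive (matching t).
Proof.
move=> eq_sz i; rewrite {2}/matching; case: ifPn => [/eqP ti|ti2].
  by have [tj ji] := nth_index_positions (esym eq_sz) ti; rewrite /matching tj.
case: ifPn => [/eqP ti|ti0]; last by rewrite /matching (negPf ti2) (negPf ti0).
by have [tj ji] := nth_index_positions eq_sz ti; rewrite /matching tj.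
Qed.

Definition step s i : 'I_3 :=
  if i < s i then ord_max else if s i < i then ord0 else inord 1.

Definition word s : n.-tuple 'I_3 := [tuple step s i | i < n].

Lemma positions_word_up s i : (i \in positions (word s) ord_max) = (i < s i).
Proof.
rewrite mem_positions tnth_mktuple /step; case: ifP => // _.
by case: ifP => // _; rewrite -val_eqE /= inordK.
Qed.

Lemma positions_word_down s i : (i \in positions (word s) ord0) = (s i < i).
Proof.
rewrite mem_positions tnth_mktuple /step; case: ltngtP => // _.
by rewrite -val_eqE /= inordK.
Qed.

(** Nested 2-cycles give a 4321 on their four endpoints. Conversely, in a 4321 at [a], [b], [c],
    [d], either [b < s b] and the cycles of [a] and [b] are nested, or [s b <= b] and those of [c]
    and [d] are. *)
Lemma invol_avoids4321P s : s^-1%g = s -> reflect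
  (forall i j, i < j -> j < s j -> s i < s j) (~~ contains [:: 4; 3; 2; 1] s).
Proof.
move=> sV; have sK : involutive s by move=> i; rewrite -{1}sV permK.
apply: (iffP idP) => [av i j ij jsj|nonnest].
  rewrite ltnNge; apply: contra av => le.
  have ne := perm_ord_neq (s := s) ij.
  by apply/contains4321P; exists i, j, (s j), (s i); rewrite !sK; lia.
apply/negP => /contains4321P[a [b [c [d [abc [cd sP]]]]]].
have [bsb|sbb] := ltnP b (s b); first by have := nonnest a b; lia.
by have := nonnest (s d) (s c); rewrite !sK; lia.
Qed.

Section Nonnesting.

Variable s : 'S_n.
Hypothesis sK : involutive s.
Hypothesis nonnest : forall i j, i < j -> j < s j -> s i < s j.

(** Nonnesting makes [s] increasing on the left endpoints of its 2-cycles, so it carries their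
    sorted list to the sorted list of right endpoints. *)
Lemma map_positions_word :
  map s (positions (word s) ord_max) = positions (word s) ord0.
Proof.
apply: (@irr_sorted_eq _ (fun i j => i < j)).
- by move=> ? ? ?; apply: ltn_trans.
- by move=> ?; apply: ltnn.
- rewrite sorted_map; apply: sub_in_sorted (allss _) (sorted_positions _ _).
  by move=> i j _; rewrite positions_word_up => jsj ij; apply: nonnest.
- exact: sorted_positions.
move=> j; rewrite positions_word_down; apply/mapP/idP => [[i]|sj].
  by rewrite positions_word_up => ? ->; rewrite sK.
by exists (s j); rewrite ?positions_word_up sK.
Qed.

Lemma Motzkin_path_word : is_Motzkin_path (word s).
Proof.
apply/Motzkin_pathP; rewrite -map_positions_word size_map; split=> // k kn.
(* Both sides now count left endpoints [i], those with [s i < k] against those with [i < k]. *)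
rewrite count_map -!size_filter; apply: uniq_leq_size.
  exact/filter_uniq/uniq_positions.
move=> i; rewrite mem_filter positions_word_up /= => /andP[lt up].
by rewrite mem_filter positions_word_up up andbT (ltn_trans up).
Qed.

Lemma matching_word : s =1 matching (word s).
Proof.
have eq_sz : size (positions (word s) ord0) = size (positions (word s) ord_max).
  by rewrite -map_positions_word size_map.
have up i : i < s i -> s i = matching (word s) i.
  rewrite -positions_word_up => i_up.
  rewrite /matching -mem_positions i_up -map_positions_word.
  by rewrite (nth_map i) ?nth_index // index_mem.
move=> i; case: (ltngtP i (s i)) => [/up //|lt|/val_inj e].
  by have := up (s i); rewrite sK => /(_ lt) {2}->; rewrite matchingK.
rewrite /matching -!mem_positions positions_word_up positions_word_down.
by rewrite -e ltnn.
Qed.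

End Nonnesting.

(** The involution is [matching t]. Each up step precedes its partner by [Motzkin_positions_ltn], so
    the word of the matching is [t]; pairing by rank is monotone, so no two 2-cycles are nested. *)
Lemma Motzkin_path_is_word t : is_Motzkin_path t ->
  exists s : 'S_n, [/\ s^-1%g = s, ~~ contains [:: 4; 3; 2; 1] s & word s = t].
Proof.
move=> Mt; have [eq_sz _] := Motzkin_pathP _ Mt; have mK := matchingK eq_sz.
have [s sE] : exists s : 'S_n, s =1 matching t.
  by exists (perm (inv_inj mK)) => i; rewrite permE.
have sK : involutive s by move=> i; rewrite !sE.
have sV : s^-1%g = s by apply/permP => i; apply: (@perm_inj _ s); rewrite permKV sK.
have up i : tnth t i == ord_max -> i < s i.
  move=> ti; rewrite sE /matching ti; have := ti; rewrite -mem_positions => it.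
  rewrite -{1}(nth_index i it); apply: Motzkin_positions_ltn => //.
  by rewrite index_mem.
have down i : tnth t i == ord0 -> s i < i.
  move=> /eqP ti; have [tj _] := nth_index_positions eq_sz ti.
  by have := up (s i); rewrite sK; apply; rewrite sE /matching ti /= tj.
have upE i : (i < s i) = (tnth t i == ord_max).
  apply/idP/idP => [|/up //]; apply: contraLR => ti2; rewrite -leqNgt.
  have [/down/ltnW //|ti0] := boolP (tnth t i == ord0).
  by rewrite sE /matching (negPf ti2) (negPf ti0).
have ltT : transitive (fun i j => i < j) by move=> ? ? ?; apply: ltn_trans.
exists s; split=> //.
  apply/(invol_avoids4321P sV) => i j ij; rewrite upE => tj.
  have [ti|] := boolP (tnth t i == ord_max); last first.
    by rewrite -upE -leqNgt => sii; move: tj; rewrite -upE; lia.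
  move: (ti) (tj); rewrite -!mem_positions => it jt.
  (* The earlier of two up steps has the smaller rank, hence the earlier partner. *)
  have lt_ij : index i (positions t ord_max) < index j (positions t ord_max).
    rewrite ltnNge leq_eqVlt; apply/negP => /orP[/eqP e|lt_ji].
      by have := nth_index i it; rewrite -e nth_index // => ji; rewrite ji ltnn in ij.
    by have := sorted_ltn_index ltT (sorted_positions t _) _ _ jt it lt_ji; lia.
  rewrite !sE /matching ti tj (set_nth_default i j); last first.
    by rewrite eq_sz index_mem.
  apply: (sorted_ltn_nth ltT i (sorted_positions t ord0)) => //.
    by rewrite inE eq_sz index_mem.
  by rewrite inE eq_sz index_mem.
apply: eq_from_tnth => i; rewrite tnth_mktuple /step upE.
case: ifPn => [/eqP -> //|ti2].
have [/eqP ti0|ti0] := boolP (tnth t i == ord0); first by rewrite down ti0.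
rewrite sE /matching (negPf ti2) (negPf ti0) ltnn; apply: val_inj.
move: ti0 ti2; rewrite /= inordK // -!val_eqE /=.
by case: (tnth t i) => [[|[|[|?]]] ?].
Qed.

(** The map [word] is injective on these involutions because [matching] undoes it, and its image is
    the set of Motzkin paths. *)
Lemma card_involutions_avoiding4321 :
  #|avoiding_involutions n [:: [:: 4; 3; 2; 1]]| = Motzkin n.
Proof.
have avP s : reflect (s^-1%g = s /\ ~~ contains [:: 4; 3; 2; 1] s)
    (s \in avoiding_involutions n [:: [:: 4; 3; 2; 1]]).
  rewrite inE /avoids /= andbT.
  by apply: (iffP andP) => -[/eqP].
have invK s : s^-1%g = s -> involutive s by move=> sV i; rewrite -{1}sV permK.
rewrite /Motzkin -(card_in_imset (f := word)).
  congr #|pred_of_set _|; apply/setP => t; rewrite inE; apply/imsetP/idP.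
    move=> [s /avP[sV /(invol_avoids4321P sV) nn] ->].
    by apply: Motzkin_path_word => //; apply: invK.
  by case/Motzkin_path_is_word => s [sV av <-]; exists s => //; apply/avP.
move=> s u /avP[sV /(invol_avoids4321P sV) ns] /avP[uV /(invol_avoids4321P uV) nu] e.
apply/permP => i; rewrite (matching_word (invK _ sV) ns) e.
by rewrite -(matching_word (invK _ uV) nu).
Qed.

End MotzkinPaths.

Theorem theorem1p6 :
  Wilf_equiv_involutions [:: [:: 4; 2; 3; 1]; [:: 5; 2; 7; 6; 1; 4; 3]]
                         [:: [:: 4; 3; 2; 1]]
  /\ (forall n : nat,
        #|avoiding_involutions n
            [:: [:: 4; 2; 3; 1]; [:: 5; 2; 7; 6; 1; 4; 3]]|
          = #|avoiding_involutions n [:: [:: 4; 3; 2; 1]]|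
        /\ #|avoiding_involutions n [:: [:: 4; 3; 2; 1]]| = Motzkin n).
Proof.
have eq_card n : #|avoiding_involutions n [:: [:: 4; 2; 3; 1]; [:: 5; 2; 7; 6; 1; 4; 3]]|
    = #|avoiding_involutions n [:: [:: 4; 3; 2; 1]]|.
  by rewrite card_involutions_avoiding4321_skeleton card_involutions_avoiding_pair_skeleton.
by split=> // n; split=> //; apply: card_involutions_avoiding4321.
Qed.
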